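(* For $n\geq 1$, $$f_n(312,213,321)=\sum_{k=1}^n k!\,S(n,k).$$
   Context: A forest on $[n]$ is an unordered rooted forest whose $n$ vertices are labeled bijectively by $[n]$. A forest avoids a pattern $\sigma$ if for every vertex $v$, the sequence of labels along the path from the root of the tree containing $v$ down to $v$ contains no subsequence in the same relative order as $\sigma$. $f_n(\sigma_1,\ldots,\sigma_m)$ is the number of forests on $[n]$ avoiding every $\sigma_i$. $S(n,k)$ is the Stirling number of the second kind. *)

(* Defs.v *)
From mathcomp Require Import all_boot.

Set Implicit Arguments.
Unset Strict Implicit.
Unset Printing Implicit Defensive.

(* An unordered rooted forest with labelled vertices is determined by its
   parent map, which sends each root to [None].  The labels 1, ..., n are
   represented by the ordinals 0, ..., n-1 of ['I_n]; patterns only see the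
   relative order of labels, so the shift is immaterial. *)
Definition parent_map (n : nat) := {ffun 'I_n -> option 'I_n}.

Definition ancestor n (p : parent_map n) (k : nat) (v : 'I_n) : option 'I_n :=
  iter k (obind p) (Some v).

(* [p] has no cycle iff the parent chain of every vertex leaves the n vertices
   after at most n steps. *)
Definition is_forest n (p : parent_map n) : bool :=
  [forall v, ancestor p n v == None].

(* [pmap id] keeps the vertices v, parent of v, ..., root, and drops the
   trailing [None]s; the reversal lists them from the root down to [v]. *)
Definition root_path n (p : parent_map n) (v : 'I_n) : seq 'I_n :=
  rev (pmap id [seq ancestor p k v | k <- iota 0 n]).

Definition order_iso (s t : seq nat) : bool :=
  (size s == size t) &&
  [forall i : 'I_(size s), forall j : 'I_(size s),
     (nth 0 s i < nth 0 s j) == (nth 0 t i < nth 0 t j)].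

(* The subsequences of [w] are the sequences [mask m w]. *)
Definition contains_pattern (sigma w : seq nat) : bool :=
  [exists m : (size w).-tuple bool, order_iso (mask m w) sigma].

Definition forest_avoids n (p : parent_map n) (sigma : seq nat) : bool :=
  [forall v, ~~ contains_pattern sigma (map val (root_path p v))].

Definition num_avoiding_forests (n : nat) (sigmas : seq (seq nat)) : nat :=
  #|[set p : parent_map n | is_forest p & all (forest_avoids p) sigmas]|.

Definition stirling2 (n k : nat) : nat :=
  #|[set P : {set {set 'I_n}} | partition P [set: 'I_n] & #|P| == k]|.

(* Main.v *)
Require Import Defs.
From mathcomp Require Import all_boot all_algebra.
From mathcomp Require Import ring zify.

(* Along a root path, a descent a > b followed by any further label c forms one
   of 321, 312, 213.  So a forest avoids these patterns iff every inner
   (non-leaf) vertex that is not a root exceeds its parent.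

   Fix the set I of k inner vertices, leaving m leaves.  The largest inner
   vertex has only leaves as children; deleting its t >= 1 children turns it
   into a leaf.  Hence the number c(m, k) of such forests satisfies
     c(m, k+1) = sum_(t >= 1) C(m, t) c(m - t + 1, k),   c(m, 0) = 1,
   whose solution is, with the sum over j truncated anywhere from m on,
     c(m, k) = sum_j j^k sum_i (-1)^i C(j, i) (-i)^m.
   By the binomial theorem, summing over all I gives
     sum_j sum_i (-1)^i C(j, i) (j - i)^n,
   and the inner sum is j! S(n, j). *)

Set Implicit Arguments.
Unset Strict Implicit.
Unset Printing Implicit Defensive.

Import GRing.Theory Num.Theory.

Local Open Scope ring_scope.

(** * Alternating binomial sums *)

(** Up to the sign [(-1) ^+ j], this is the [j]-th finite difference of [f] at 0. *)
Definition alt_sum (j : nat) (f : nat -> int) : int :=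
  \sum_(i < j.+1) (-1) ^+ i * 'C(j, i)%:R * f i.

Lemma eq_alt_sum j (f g : nat -> int) : f =1 g -> alt_sum j f = alt_sum j g.
Proof. by move=> fg; apply: eq_bigr => i _; rewrite fg. Qed.

Lemma alt_sumD j f g :
  alt_sum j (fun i => f i + g i) = alt_sum j f + alt_sum j g.
Proof. by rewrite -big_split; apply: eq_bigr => i _; rewrite mulrDr. Qed.

Lemma alt_sumZ j a f : alt_sum j (fun i => a * f i) = a * alt_sum j f.
Proof. by rewrite mulr_sumr; apply: eq_bigr => i _; rewrite mulrCA. Qed.

Lemma alt_sum_sum (T : finType) (P : pred T) j (F : T -> nat -> int) :
  alt_sum j (fun i => \sum_(t | P t) F t i) = \sum_(t | P t) alt_sum j (F t).
Proof.
by rewrite exchange_big; apply: eq_bigr => i _; rewrite mulr_sumr.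
Qed.

(** Pascal's rule. In terms of the shift [E], one factor is split off [(1 - E)^(j+1)]. *)
Lemma alt_sumS j f : alt_sum j.+1 f = alt_sum j f - alt_sum j (f \o succn).
Proof.
rewrite /alt_sum big_ord_recl [in RHS]big_ord_recl -addrA; congr (_ + _).
  by rewrite !bin0.
(* The range gains one index, whose term vanishes because ['C(j, j.+1) = 0]. *)
have -> : \sum_(i < j) (-1) ^+ lift ord0 i * 'C(j, lift ord0 i)%:R
             * f (lift ord0 i)
          = \sum_(i < j.+1) (-1) ^+ i.+1 * 'C(j, i.+1)%:R * f i.+1 :> int.
  by rewrite [RHS]big_ord_recr /= bin_small // mulr0 mul0r addr0.
rewrite -sumrB; apply: eq_bigr => i _.
by rewrite lift0 /= binS natrD exprS; ring.
Qed.

(* Telescopes, because [(j - i) * 'C(j, i) = i.+1 * 'C(j, i.+1)]. *)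
Lemma alt_sum_absorb j (g : nat -> int) :
  alt_sum j (fun i => (j%:R - i%:R) * g i.+1 + i%:R * g i) = 0.
Proof.
suff H r : (r <= j.+1)%N -> \sum_(i < r) (-1) ^+ i * 'C(j, i)%:R *
   ((j%:R - i%:R) * g i.+1 + i%:R * g i)
   = - (-1) ^+ r * r%:R * 'C(j, r)%:R * g r :> int.
  by rewrite /alt_sum H // bin_small // mulr0 mul0r.
elim: r => [|r IHr] rj; first by rewrite big_ord0 mulr0 !mul0r.
rewrite big_ord_recr /= IHr 1?ltnW //.
have := congr1 (fun x : nat => x%:R : int) (mul_bin_left j r).
rewrite !natrM natrB // => E.
have -> : - (-1) ^+ r.+1 * r.+1%:R * 'C(j, r.+1)%:R * g r.+1 =
  - (-1) ^+ r.+1 * (r.+1%:R * 'C(j, r.+1)%:R) * g r.+1 :> int by ring.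
rewrite E exprS; ring.
Qed.

(** Each difference lowers the degree of a polynomial, so [j] of them annihilate every degree below
    [j]. *)
Lemma alt_sum_exp_eq0 j m (x : int) :
  (m < j)%N -> alt_sum j (fun i => (x - i%:R) ^+ m) = 0.
Proof.
elim: j m x => // j IHj m x mj.
(* The separated power [m] cancels against the shifted sum of [alt_sumS]; the powers [t < m] fall
   under the induction hypothesis. *)
have E i : (x - i%:R) ^+ m = (x - 1 - i%:R) ^+ m
    + \sum_(t < m) 'C(m, t)%:R * (x - 1 - i%:R) ^+ t :> int.
  rewrite (_ : x - i%:R = 1 + (x - 1 - i%:R)); last by ring.
  rewrite exprDn big_ord_recr /= binn subnn expr0 mul1r addrC; congr (_ + _).
  by apply: eq_bigr => t _; rewrite expr1n mul1r mulr_natl.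
rewrite alt_sumS (eq_alt_sum j E) alt_sumD alt_sum_sum addrAC.
rewrite [X in _ - X](_ : _ = alt_sum j (fun i => (x - 1 - i%:R) ^+ m)); last first.
  by apply: eq_alt_sum => i /=; congr (_ ^+ _); rewrite -[in LHS]natr1; ring.
rewrite subrr add0r big1 // => t _.
by rewrite alt_sumZ IHj ?mulr0 //; apply: leq_trans (ltn_ord t) _.
Qed.

(** This is the base case [c(m, 0) = 1]. The summand is the shift of [g], so by [alt_sumS] the sum
    telescopes to [g 0 = 1] minus a difference of order [N.+1 > m], which is 0. *)
Lemma sum_alt_sum_exp N m : (m <= N)%N ->
  \sum_(j < N.+1) alt_sum j (fun i => (- i%:R) ^+ m) = 1.
Proof.
move=> mN; pose g i : int := (1 - i%:R) ^+ m.
have H r : \sum_(j < r) alt_sum j (g \o succn) = 1 - alt_sum r g.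
  elim: r => [|r IHr].
    rewrite big_ord0 /alt_sum big_ord1 /= expr0 bin0 !mul1r /g subr0 expr1n.
    by rewrite subrr.
  by rewrite big_ord_recr IHr alt_sumS /=; ring.
rewrite (eq_bigr (fun j : 'I_N.+1 => alt_sum j (g \o succn))); last first.
  by move=> j _; apply: eq_alt_sum => i; rewrite /g /= -natr1 opprD addrCA subrr addr0.
by rewrite H alt_sum_exp_eq0 ?subr0.
Qed.

(** The binomial theorem, with the subsets of each size left ungrouped to match sums over sets of
    children or blocks. *)
Lemma sum_subset_exp (T : finType) (D : {set T}) (x y : int) :
  \sum_(C : {set T} | C \subset D) x ^+ #|C| * y ^+ (#|D| - #|C|)
  = (x + y) ^+ #|D|.
Proof.
rewrite addrC exprDn.
rewrite (partition_big (fun C : {set T} => inord #|C| : 'I_#|D|.+1) predT) //=.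
apply: eq_bigr => t _.
rewrite -mulr_natr -[in RHS]cards_draws mulr_natr -sumr_const.
apply: eq_big => [C|C /andP[CD /eqP <-]].
  rewrite inE; case CD: (C \subset D) => //=.
  by rewrite -val_eqE /= inordK // ltnS subset_leq_card.
by rewrite inordK ?ltnS ?subset_leq_card // mulrC.
Qed.

(** * Set partitions and Stirling numbers *)

(** The set [D] is arbitrary because the induction removes blocks from it. *)
Definition set_partitions (T : finType) (D : {set T}) k : {set {set {set T}}} :=
  [set P | partition P D & #|P| == k].

(** Removing the block [B] is a bijection onto the partitions of the rest of [D]. *)
Lemma card_set_partitions_block (T : finType) (D B : {set T}) k :
  #|[set P in set_partitions D k.+1 | B \in P]|
  = if (B \subset D) && (B != set0) then #|set_partitions (D :\: B) k| else 0%N.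
Proof.
case: ifP => [/andP[BD B0]|BDF]; last first.
  apply/eqP; rewrite cards_eq0; apply/set0Pn => -[P]; rewrite !inE.
  case/andP=> /andP[pP _] BP; move/negbT/negP: BDF; apply; apply/andP; split.
    by rewrite -(cover_partition pP); apply: bigcup_sup BP.
  by apply: contraTneq BP => ->; case/and3P: pP.
have notB P : partition P (D :\: B) -> B \notin P.
  move=> pP; apply/negP => BP; case/set0Pn: B0 => x xB.
  have := subsetP (bigcup_sup B BP (F := id)) x xB.
  by rewrite -/(cover P) (cover_partition pP) inE xB.
have -> : [set P in set_partitions D k.+1 | B \in P]
        = (fun P => B |: P) @: set_partitions (D :\: B) k.
  apply/setP => P; apply/idP/imsetP => [|[P' + ->]]; rewrite !inE.
    case/andP=> /andP[pP /eqP cP] BP; exists (P :\ B); last by rewrite setD1K.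
    by rewrite inE partitionD1 //=; move: cP; rewrite (cardsD1 B) BP add1n => -[->].
  case/andP=> pP /eqP cP; rewrite eqxx andbT cardsU1 notB // cP add1n eqxx andbT.
  rewrite -[X in partition _ X](setID D B) (setIidPr BD) partitionU1 //.
  by rewrite disjoint_sym disjoints_subset subsetDr.
apply: card_in_imset => P Q; rewrite !inE => /andP[pP _] /andP[pQ _] PQ.
by rewrite -(setU1K (notB P pP)) PQ setU1K // notB.
Qed.

(** Double counting of the pairs of a partition and one of its blocks. *)
Lemma sum_card_set_partitions (T : finType) (D : {set T}) k :
  (k.+1 * #|set_partitions D k.+1|
   = \sum_(B : {set T} | (B \subset D) && (B != set0))
        #|set_partitions (D :\: B) k|)%N.
Proof.
transitivity (\sum_(P in set_partitions D k.+1) \sum_(B in P) 1)%N.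
  rewrite mulnC -sum_nat_const; apply: eq_bigr => P; rewrite inE => /andP[_ /eqP <-].
  by rewrite sum1_card.
rewrite (exchange_big_dep predT) //= [RHS]big_mkcond; apply: eq_bigr => B _ /=.
rewrite -card_set_partitions_block -sum1_card.
by apply: eq_bigl => P; rewrite inE.
Qed.

(** Both sides count the surjections from [D] onto a [k]-set, the right one by inclusion-exclusion.
    The proof is an induction removing one block. *)
Lemma fact_card_set_partitions (T : finType) k (D : {set T}) :
  (k`! * #|set_partitions D k|)%:R
  = alt_sum k (fun i => (k%:R - i%:R) ^+ #|D|).
Proof.
elim: k D => [|k IHk] D.
  rewrite /alt_sum big_ord1 /= expr0 bin0 !mul1r subrr mul1n expr0n cards_eq0.
  congr (_%:R); have -> : set_partitions D 0 = if D == set0 then [set set0] else set0.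
    apply/setP => P; rewrite inE cards_eq0.
    case: ifPn => D0; rewrite !inE.
      case: (eqVneq P set0) => [->|]; rewrite ?andbF // andbT (eqP D0).
      by rewrite partition_set0 eqxx.
    apply/negP => /andP[pP /eqP P0]; move: D0.
    by rewrite -(cover_partition pP) P0 /cover big_set0 eqxx.
  by case: ifP; rewrite ?cards1 ?cards0.
rewrite factS [(k.+1 * _)%N]mulnC -mulnA sum_card_set_partitions.
rewrite big_distrr natr_sum /= (eq_bigr _ (fun B _ => IHk (D :\: B))) -alt_sum_sum.
(* The added sum is the missing term [B = set0] in the expansion of [(1 + (k - i)) ^+ #|D|] over
   subsets; on the right it cancels the shifted sum. *)
rewrite alt_sumS; apply: (addIr (alt_sum k (fun i => (k%:R - i%:R) ^+ #|D|))).
rewrite [X in _ - X](_ : _ = alt_sum k (fun i => (k%:R - i%:R) ^+ #|D|)); last first.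
  by apply: eq_alt_sum => i /=; congr (_ ^+ _); rewrite -!natr1; ring.
rewrite subrK -alt_sumD; apply: eq_alt_sum => i.
rewrite [in RHS](_ : k.+1%:R - i%:R = 1 + (k%:R - i%:R)); last by rewrite -natr1; ring.
rewrite -(sum_subset_exp D 1) [RHS](bigD1 set0) ?sub0set //= cards0 subn0 mul1r addrC.
congr (_ + _); apply: eq_bigr => B /andP[BD _].
by rewrite expr1n mul1r cardsD (setIidPr BD).
Qed.

(** * Counting forests with a given set of inner vertices *)

(* [I] is the set of inner vertices of a forest on [S]; the vertices outside [S]
   are isolated roots. *)
Definition increasing_maps n (S I : {set 'I_n}) : {set parent_map n} :=
  [set p : parent_map n |
    [&& [forall v, (v \notin S) ==> (p v == None)],
        [forall u, (u \in I) == [exists v, p v == Some u]] &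
        [forall v, forall u, (v \in I) ==> (p v == Some u) ==> (u < v)%N]]].

Lemma increasing_mapsP n (S I : {set 'I_n}) (p : parent_map n) :
  reflect [/\ forall v u, p v = Some u -> (v \in S) && (u \in I),
              forall u, u \in I -> exists v, p v = Some u &
              forall v u, v \in I -> p v = Some u -> (u < v)%N]
          (p \in increasing_maps S I).
Proof.
rewrite inE; apply: (iffP and3P) => -[].
  move=> /forallP pS /forallP pI /forallP pL; split=> [v u pv|u uI|v u vI pv].
  - apply/andP; split.
      by apply/negP => /negP vS; have := implyP (pS v) vS; rewrite pv.
    by rewrite (eqP (pI u)); apply/existsP; exists v; rewrite pv.
  - by have := pI u; rewrite uI eq_sym => /eqP/existsP[v /eqP]; exists v.
  - by have /forallP/(_ u) := pL v; rewrite vI pv eqxx.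
move=> pS pI pL; split; apply/forallP.
- move=> v; apply/implyP => vS; case pv: (p v) => [u|//].
  by have := pS _ _ pv; rewrite (negbTE vS).
- move=> u; apply/eqP; apply/idP/existsP => [/pI[v pv]|[v /eqP/pS/andP[]//]].
  by exists v; rewrite pv.
- move=> v; apply/forallP => u; apply/implyP => vI; apply/implyP => /eqP.
  exact: pL.
Qed.

Definition children n (p : parent_map n) u := [set v | p v == Some u].

(** Detaching [C] turns [M] into a leaf and isolates the vertices of [C]; attaching them again is
    the inverse. An inner child of [M] would have to exceed [M], so [C] consists of leaves. *)
Lemma card_increasing_maps_children n (S I C : {set 'I_n}) M :
    I \subset S -> M \in I -> (forall v, v \in I -> v <= M)%N ->
  #|[set p in increasing_maps S I | children p M == C]|
  = if (C \subset S :\: I) && (C != set0)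
    then #|increasing_maps (S :\: C) (I :\ M)| else 0%N.
Proof.
move=> IS MI maxM; case: ifP => [/andP[CS C0]|CF]; last first.
  apply/eqP; rewrite cards_eq0; apply/set0Pn => -[p]; rewrite inE.
  case/andP=> /increasing_mapsP[pS pI pL] /eqP CE; move/negP: CF; apply.
  rewrite -CE; apply/andP; split; last first.
    by have [v pv] := pI _ MI; apply/set0Pn; exists v; rewrite inE pv.
  apply/subsetP => v; rewrite !inE => /eqP pv.
  have /andP[-> _] := pS _ _ pv; rewrite andbT; apply/negP => vI.
  by have := pL _ _ vI pv; rewrite ltnNge maxM.
have CnI v : v \in C -> v \notin I by move/(subsetP CS); rewrite inE => /andP[].
have CinS v : v \in C -> v \in S by move/(subsetP CS); rewrite inE => /andP[].
pose attach (p : parent_map n) : parent_map n :=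
  [ffun v => if v \in C then Some M else p v].
pose detach (p : parent_map n) : parent_map n :=
  [ffun v => if v \in C then None else p v].
have detachK : {in [set p in increasing_maps S I | children p M == C],
                 cancel detach attach}.
  move=> p; rewrite inE => /andP[_ /eqP CE]; apply/ffunP => v; rewrite !ffunE.
  case vC: (v \in C) => //; by move: vC; rewrite -CE inE => /eqP.
rewrite -(card_in_imset (can_in_inj detachK)); congr #|pred_of_set _|.
apply/setP => q; apply/imsetP/increasing_mapsP => [[p + ->]|[qS qI qL]].
  rewrite inE => /andP[/increasing_mapsP[pS pI pL] /eqP CE]; split.
  - move=> v u; rewrite ffunE; case: ifPn => // vC pv; rewrite !inE vC /=.
    have /andP[-> ->] := pS _ _ pv; rewrite andbT /=.
    by apply: contraNneq vC => uM; rewrite -CE inE pv uM.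
  - move=> u; rewrite !inE => /andP[uM uI]; have [v pv] := pI _ uI.
    exists v; rewrite ffunE ifN //; apply: contraNN uM.
    by rewrite -CE inE pv.
  - move=> v u; rewrite !inE ffunE => /andP[_ vI]; case: ifP => // _.
    exact: pL.
have qC v : v \in C -> q v = None.
  by move=> vC; case qv: (q v) => [u|//]; have := qS _ _ qv; rewrite inE vC.
exists (attach q); last first.
  by apply/ffunP => v; rewrite !ffunE; case vC: (v \in C) => //; rewrite qC.
rewrite inE; apply/andP; split; last first.
  apply/eqP/setP => v; rewrite inE ffunE; case: ifP => [|_]; rewrite ?eqxx //.
  by apply/eqP => /qS; rewrite !inE eqxx andbF.
apply/increasing_mapsP; split.
- move=> v u; rewrite ffunE; case: ifP => [/CinS -> [<-]|_ /qS]; rewrite ?MI //.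
  by rewrite !inE => /andP[/andP[_ ->] /andP[_ ->]].
- move=> u uI; case: (eqVneq u M) => [->|uM].
    by case/set0Pn: C0 => v vC; exists v; rewrite ffunE vC.
  have [|v qv] := qI u; first by rewrite !inE uM.
  by exists v; rewrite ffunE; case: ifP => // /qC; rewrite qv.
- move=> v u vI; rewrite ffunE ifN; last by apply/negP => /CnI; rewrite vI.
  (* [M] is a leaf of [q], so [qL] does not apply to it; maximality puts its parent below it. *)
  case: (eqVneq v M) => [->|vM qv]; last by apply: qL => //; rewrite !inE vM.
  move=> qM; have /andP[_] := qS _ _ qM; rewrite !inE => /andP[uM uI].
  by rewrite ltn_neqAle maxM // andbT.
Qed.

Lemma card_increasing_maps0 n (S : {set 'I_n}) : #|increasing_maps S set0| = 1%N.
Proof.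
apply/eqP/cards1P; exists [ffun => None].
apply/setP => p; rewrite inE; apply/increasing_mapsP/eqP => [[pS _ _]|->].
  apply/ffunP => v; rewrite ffunE; case pv: (p v) => [u|//].
  by have := pS _ _ pv; rewrite inE andbF.
by split=> v; rewrite ?inE // => u; rewrite ?inE // ffunE.
Qed.

Lemma card_increasing_maps n (S I : {set 'I_n}) : I \subset S ->
  #|increasing_maps S I|%:R
  = \sum_(j < n.+1) j%:R ^+ #|I| * alt_sum j (fun i => (- i%:R) ^+ (#|S| - #|I|)).
Proof.
move Ek: #|I| => k; elim: k S I Ek => [|k IHk] S I Ik IS.
  rewrite (cards0_eq Ik) card_increasing_maps0 subn0.
  rewrite (eq_bigr _ (fun j _ => mul1r _)) sum_alt_sum_exp //.
  by rewrite -[X in (_ <= X)%N]card_ord max_card.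
have /card_gt0P[M0 M0I] : (0 < #|I|)%N by rewrite Ik.
have [M MI maxM] : exists2 M, M \in I & forall v, v \in I -> (v <= M)%N.
  by have [M] := arg_maxnP val M0I; exists M.
have -> : #|increasing_maps S I|
  = (\sum_(C : {set 'I_n} | (C \subset S :\: I) && (C != set0))
      #|increasing_maps (S :\: C) (I :\ M)|)%N.
  rewrite -sum1_card (partition_big (fun p => children p M) predT) //=.
  rewrite [RHS]big_mkcond; apply: eq_bigr => C _ /=.
  rewrite -(card_increasing_maps_children _ IS MI maxM) -sum1_card.
  by apply: eq_bigl => p; rewrite inE.
have IMk : #|I :\ M| = k by move: Ik; rewrite (cardsD1 M) MI add1n => -[].
have cSI : #|S :\: I| = (#|S| - k.+1)%N by rewrite cardsD (setIidPr IS) Ik.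
have kS : (k < #|S|)%N by rewrite -Ik subset_leq_card.
pose m := (#|S| - k.+1)%N.
(* The [#|C|] leaves in [C] are lost and [M] becomes a new leaf. *)
have EC (C : {set 'I_n}) : C \subset S :\: I ->
    (#|S :\: C| - k = (m - #|C|).+1)%N /\ I :\ M \subset S :\: C.
  move=> CS; have CS' := subset_trans CS (subsetDl S I); split.
    by have := subset_leq_card CS; rewrite cSI cardsD (setIidPr CS') /m; lia.
  apply/subsetP => v; rewrite !inE => /andP[_ vI]; rewrite (subsetP IS) // andbT.
  by apply/negP => /(subsetP CS); rewrite inE vI.
rewrite natr_sum (eq_bigr (fun C : {set 'I_n} => \sum_(j < n.+1) j%:R ^+ k *
     alt_sum j (fun i => (- i%:R) ^+ (m - #|C|).+1))); last first.
  by move=> C /andP[/EC[E1 E2] _]; rewrite (IHk _ _ IMk E2) E1.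
rewrite exchange_big; apply: eq_bigr => j _.
rewrite -mulr_sumr exprSr -mulrA; congr (_ * _); rewrite -alt_sum_sum -alt_sumZ.
apply/esym/eqP; rewrite -subr_eq0 -mulN1r -alt_sumZ -alt_sumD.
(* With [g i = (1 - i) ^+ m], the nonempty [C] contribute [- i * (g i - g i.+1)], since
   [g i.+1 = (- i) ^+ m]. Subtracting this from [j * g i.+1] gives the summand of
   [alt_sum_absorb]. *)
rewrite -[X in _ == X](alt_sum_absorb j (fun i => (1 - i%:R) ^+ m)).
apply/eqP/eq_alt_sum => i.
have -> : 1 - i.+1%:R = - i%:R :> int by rewrite -natr1; ring.
have := sum_subset_exp (S :\: I) 1 (- i%:R).
rewrite (bigD1 set0) ?sub0set //= cards0 subn0 mul1r cSI -/m => <-.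
set A := (X in _ + -1 * X = _); set B := (X in _ = _ + _ * (_ + X)).
have -> : A = - i%:R * B.
  by rewrite mulr_sumr; apply: eq_bigr => C _; rewrite expr1n mul1r exprS.
ring.
Qed.

Lemma sum_card_increasing_maps n :
  (\sum_(I : {set 'I_n}) #|increasing_maps setT I|)%:R
  = \sum_(j < n.+1) alt_sum j (fun i => (j%:R - i%:R) ^+ n).
Proof.
rewrite natr_sum (eq_bigr _ (fun I _ => card_increasing_maps (subsetT I))).
rewrite exchange_big; apply: eq_bigr => j _.
under eq_bigr do rewrite -alt_sumZ; rewrite -alt_sum_sum; apply: eq_alt_sum => i.
have := sum_subset_exp [set: 'I_n] j%:R (- i%:R).
by rewrite cardsT card_ord => <-; apply: eq_bigl => I; rewrite subsetT.
Qed.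

Local Close Scope ring_scope.

(** * Parent chains in increasing forests *)

(** This is [root_path] before reversal, with a free length so that vertices can be peeled off from
    [v] upwards. *)
Definition parent_chain n (p : parent_map n) m v : seq 'I_n :=
  pmap id [seq ancestor p k v | k <- iota 0 m].

Lemma ancestorS n (p : parent_map n) k v :
  ancestor p k.+1 v = if p v is Some u then ancestor p k u else None.
Proof. by rewrite /ancestor iterSr /=; case: (p v) => [//|]; elim: k => //= k ->. Qed.

Lemma ancestorD n (p : parent_map n) a b v :
  ancestor p (a + b) v = obind (ancestor p a) (ancestor p b v).
Proof.
by elim: b v => [|b IHb] v; rewrite ?addn0 // addnS !ancestorS; case: (p v).
Qed.

Lemma parent_chainS n (p : parent_map n) m v :
  parent_chain p m.+1 v = v :: if p v is Some u then parent_chain p m u else [::].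
Proof.
rewrite /parent_chain /= -[1]addn0 iotaDl -map_comp; congr (_ :: _).
rewrite (eq_map (g := fun k => if p v is Some u then ancestor p k u else None)).
  by case: (p v) => // ; elim: iota.
by move=> k; apply: ancestorS.
Qed.

Definition inner n (p : parent_map n) v := exists w, p w = Some v.

Definition increasing n (p : parent_map n) :=
  forall v u, inner p v -> p v = Some u -> u < v.

(** Every proper ancestor is inner, so each step towards the root lowers the label by at least 1. *)
Lemma ancestor_inner n (p : parent_map n) (p_incr : increasing p) k v u :
  inner p v -> ancestor p k v = Some u -> inner p u /\ u + k <= v.
Proof.
elim: k v => [|k IHk] v pv; first by case=> <-; rewrite addn0.
rewrite ancestorS; case pvE: (p v) => [x|//] /IHk[|? xu]; first by exists v.
by split=> //; have := p_incr _ _ pv pvE; lia.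
Qed.

Lemma parent_chain_sorted n (p : parent_map n) (p_incr : increasing p) m v :
  inner p v -> sorted (fun a b : 'I_n => b < a) (parent_chain p m v).
Proof.
elim: m v => [//|m IHm] v pv; rewrite parent_chainS /=.
case pvE: (p v) => [u|//]; have pu : inner p u by exists v.
have := IHm u pu; case: m {IHm} => [//|m]; rewrite parent_chainS /= => ->.
by rewrite p_incr.
Qed.

(* A chain of length [n] from a leaf [v] would run through the inner vertices
   [n.-1, n.-2, ..., 0], hence through [v]. *)
Lemma increasing_forest n (p : parent_map n) : increasing p -> is_forest p.
Proof.
move=> p_incr; apply/forallP => v; case E: (ancestor p n v) => [r|//].
have v_leaf : ~ inner p v.
  by move=> pv; have [_] := ancestor_inner p_incr pv E; have := ltn_ord v; lia.
have vn := ltn_ord v.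
(* The vertex [u] reached after [n - v] steps satisfies [u <= v], and the [v] steps still possible
   from it force [v <= u]. *)
have : ancestor p (v + (n - v)) v = Some r by rewrite subnKC // ltnW.
rewrite ancestorD.
case Eu: (ancestor p (n - v) v) => [u|//] /= Er.
have := Eu; rewrite -(subnSK vn) ancestorS; case pv: (p v) => [x|//].
have px : inner p x by exists v.
case/(ancestor_inner p_incr px) => pu ux; have [_ ru] := ancestor_inner p_incr pu Er.
case: v_leaf; rewrite (_ : v = u) //; apply: val_inj => /=.
by have := ltn_ord x; lia.
Qed.

(** * Pattern avoidance as a condition on parents *)

Lemma contains_patternP sigma w :
  reflect (exists2 s, subseq s w & order_iso s sigma) (contains_pattern sigma w).
Proof.
apply: (iffP existsP) => [[m mP]|[s /subseqP[m /eqP sm ->]]].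
  by exists (mask m w) => //; apply: mask_subseq.
by exists (Tuple sm).
Qed.

(** The initial descent is all that 312, 213 and 321 need to share for [increasing_avoids]. *)
Lemma order_iso3_descent s x y z :
    order_iso s [:: x; y; z] -> y < x ->
  exists a b c, s = [:: a; b; c] /\ b < a.
Proof.
case: s => [|a [|b [|c []]]] //= /andP[_ /forallP H] yx.
exists a, b, c; split=> //.
have /forallP/(_ (@Ordinal 3 0 isT))/eqP /= := H (@Ordinal 3 1 isT).
by rewrite yx.
Qed.

Lemma order_iso3_perm a b c x y z :
    (a < b) = (x < y) -> (b < a) = (y < x) -> (a < c) = (x < z) ->
    (c < a) = (z < x) -> (b < c) = (y < z) -> (c < b) = (z < y) ->
  order_iso [:: a; b; c] [:: x; y; z].
Proof.
move=> ab ba ac ca bc cb.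
apply/andP; split=> //; apply/forallP => i; apply/forallP => j; apply/eqP.
case: i => [[|[|[|i]]]] //= _; case: j => [[|[|[|j]]]] //= _.
all: by rewrite ?ltnn.
Qed.

Lemma increasing_avoids n (p : parent_map n) x y z :
  increasing p -> y < x -> forest_avoids p [:: x; y; z].
Proof.
move=> p_incr yx; apply/forallP => w; apply/contains_patternP => -[s sw].
case/order_iso3_descent=> // a [b [c [sE ba]]].
case: n p p_incr w sw => [|n] p p_incr w; first by case: w.
rewrite /root_path -/(parent_chain p n.+1 w) parent_chainS.
(* [t] lists the proper ancestors of [w]; they are inner, hence decreasing towards the root. *)
set t := (X in w :: X) => sw.
have t_sorted : sorted gtn (map val t).
  rewrite sorted_map /t; case pw: (p w) => [v|//].
  by apply: parent_chain_sorted => //; exists w.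
have := sw; rewrite map_rev -subseq_rev revK sE /= => cba.
(* Only [c] can be matched with [w] itself, so [b] and [a] lie in [t] in either case. *)
have : subseq [:: b; a] (map val t).
  move: cba; rewrite [rev _]/=; case: eqP => // _.
  by apply: subseq_trans; apply: subseq_cons.
move/subseq_sorted => /(_ gtn) ; have gtn_trans : transitive gtn by move=> i j k; lia.
by move=> /(_ gtn_trans t_sorted) /=; rewrite andbT ltnNge ltnW.
Qed.

(** Going [n] times around a cycle takes at least [n] steps, after which a forest leaves no
    vertex. *)
Lemma forest_acyclic n (p : parent_map n) k x :
  is_forest p -> ancestor p k.+1 x <> Some x.
Proof.
move=> /forallP pF xx.
have : ancestor p (n * k.+1) x = Some x.
  by move: (n in n * _) => m; elim: m => // m IHm; rewrite mulSn ancestorD IHm.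
by rewrite mulnS addnC ancestorD (eqP (pF x)).
Qed.

Lemma avoids_increasing n (p : parent_map n) :
    is_forest p ->
    all (forest_avoids p) [:: [:: 3; 1; 2]; [:: 2; 1; 3]; [:: 3; 2; 1]] ->
  increasing p.
Proof.
move=> pF /= /and4P[/forallP/(_ _)/contains_patternP p312].
move=> /forallP/(_ _)/contains_patternP p213 /forallP/(_ _)/contains_patternP p321 _.
move=> v u [w pw] pv.
have uv : val u != val v.
  by apply/eqP => /val_inj uv; apply: (@forest_acyclic _ p 0 v pF); rewrite ancestorS pv uv.
have vw : val v != val w.
  by apply/eqP => /val_inj vw; apply: (@forest_acyclic _ p 0 w pF); rewrite ancestorS pw vw.
have uw : val u != val w.
  apply/eqP => /val_inj uw; apply: (@forest_acyclic _ p 1 w pF).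
  by rewrite !ancestorS pw ancestorS pv uw.
have sub : subseq [:: val u; val v; val w] (map val (root_path p w)).
  rewrite /root_path -/(parent_chain p n w) map_rev -subseq_rev revK.
  (* [root_path] keeps at most [n] entries; three distinct labels force [n >= 3], so none of them is
     cut off. *)
  case: n p w v u {pF p312 p213 p321} pw pv uv vw uw => [|[|[|n]]] p w v u pw pv uv vw uw.
  - by have := ltn_ord w.
  - by move: uv (ltn_ord u) (ltn_ord v) => /=; lia.
  - by move: uv vw uw (ltn_ord u) (ltn_ord v) (ltn_ord w) => /=; lia.
  by rewrite parent_chainS pw parent_chainS pv parent_chainS /rev /= !eqxx sub0seq.
move: uv vw uw => /= uv vw uw; rewrite ltnNge; apply/negP => vu.
(* Given the descent from [u] to [v], the position of [w] below, between or above them selects 321,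
   312 or 213. *)
case: (ltnP w v) => wv; last case: (ltnP w u) => wu.
- by case: (p321 w); exists [:: val u; val v; val w] => //; apply: order_iso3_perm => /=; lia.
- by case: (p312 w); exists [:: val u; val v; val w] => //; apply: order_iso3_perm => /=; lia.
- by case: (p213 w); exists [:: val u; val v; val w] => //; apply: order_iso3_perm => /=; lia.
Qed.

(** * Summation over the sets of inner vertices *)

Lemma num_avoiding_forests_increasing n :
  num_avoiding_forests n [:: [:: 3; 1; 2]; [:: 2; 1; 3]; [:: 3; 2; 1]]
  = \sum_(I : {set 'I_n}) #|increasing_maps setT I|.
Proof.
rewrite /num_avoiding_forests -sum1_card.
pose im (p : parent_map n) := [set u | [exists v, p v == Some u]].
rewrite (partition_big im predT) //=; apply: eq_bigr => I _.
rewrite sum1dep_card; apply: eq_card => p; rewrite [LHS]inE inE.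
have imP u : reflect (inner p u) (u \in im p).
  rewrite inE; apply: (iffP existsP) => [[v /eqP]|[v pv]]; first by exists v.
  by exists v; rewrite pv.
apply/idP/increasing_mapsP => [/andP[/andP[pF pA] /eqP <-]|[pS pI pL]].
  have p_incr := avoids_increasing pF pA; split=> [v u pv|u /imP //|v u /imP].
    by rewrite inE; apply/imP; exists v.
  exact: p_incr.
have imE : im p = I.
  by apply/setP => u; apply/imP/idP => [[v /pS/andP[]]|/pI].
have p_incr : increasing p by move=> v u /imP; rewrite imE; apply: pL.
by rewrite imE eqxx increasing_forest //= !increasing_avoids.
Qed.

Theorem theorem5p3 (n : nat) (hn : 1 <= n) :
  num_avoiding_forests n [:: [:: 3; 1; 2]; [:: 2; 1; 3]; [:: 3; 2; 1]]
  = \sum_(1 <= k < n.+1) k`! * stirling2 n k.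
Proof.
rewrite num_avoiding_forests_increasing.
apply/eqP; rewrite -(eqr_nat int) sum_card_increasing_maps natr_sum.
rewrite big_add1 /= big_mkord big_ord_recl /=.
(* The term [j = 0] is [0 ^+ n], which vanishes because [n] is positive. *)
rewrite [X in (X + _)%R](_ : _ = 0%R) ?add0r.
  apply/eqP/eq_bigr => k _; rewrite /stirling2 -/(set_partitions setT _).
  by rewrite fact_card_set_partitions cardsT card_ord.
by rewrite /alt_sum big_ord1 subrr expr0n eqn0Ngt hn mulr0.
Qed.
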